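(* Let $K>1$, $\theta\in(-\pi/2,\pi/2]$, $c\in\mathbb{C}$ and $f(z)=h_{K,\theta}(z)^2+c$. If $f$ has exactly one fixed external ray $E_\phi$, then $\bigcup_{k=0}^\infty f^{-k}(E_\phi)$ is dense in a neighbourhood of infinity. If $f$ has exactly two or exactly three fixed external rays, then the basin of attraction of the fixed external ray that is not locally repelling is dense in a neighbourhood of infinity.
   Context: For $K>1$ and $\theta\in(-\pi/2,\pi/2]$, $h_{K,\theta}(z)=\frac{K+1}{2}z+e^{2i\theta}\frac{K-1}{2}\overline{z}$, and $H=h_{K,\theta}^2$. A ray is $R_\varphi=\{te^{i\varphi}:t\ge0\}$. $H$ sends rays to rays and induces $\widetilde H:\mathbb{R}/2\pi\mathbb{Z}\to\mathbb{R}/2\pi\mathbb{Z}$, $\widetilde H(\varphi)=\arg H(re^{i\varphi})$ (any $r>0$). A ray $R_\phi$ is fixed by $H$ if $\widetilde H(\phi)=\phi$, and it is then locally repelling if $\widetilde H'(\phi)>1$. Böttcher coordinate (known from earlier work): for each $K,\theta,c$ there are a neighbourhood $U$ of infinity with $f(U)\subset U$ and a quasiconformal map $\psi$ from $U$ onto a neighbourhood $\psi(U)$ of infinity, with $\psi(z)\to\infty$ as $z\to\infty$, such that $H(\psi(z))=\psi(f(z))$ for $z\in U$. Fix such $U,\psi$. The external ray of $f$ with angle $\varphi$ is $E_\varphi=\psi^{-1}(R_\varphi\cap\psi(U))$. It is fixed by $f$ if $f(E_\varphi)\subset E_\varphi$, and a fixed external ray $E_\varphi$ is locally repelling if the fixed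 ray $R_\varphi$ of $H$ is. When there are two or three fixed external rays, exactly one of them, $E_{\phi_0}$, is not locally repelling; its basin of attraction is $\bigcup\{E_\varphi:\widetilde H^n(\varphi)\to\phi_0\text{ as } n\to\infty\}$. A set is dense in a neighbourhood of infinity if there is a neighbourhood $V$ of infinity such that the intersection of the set with $V$ is dense in $V$. *)

(* Defs.v *)
From HB Require Import structures.
From mathcomp Require Import all_boot all_order all_algebra.
From mathcomp Require Import all_classical all_reals all_analysis.
From mathcomp Require Export complex.

Set Implicit Arguments.
Unset Strict Implicit.
Unset Printing Implicit Defensive.

Import Order.TTheory GRing.Theory Num.Theory.
Import numFieldNormedType.Exports.

Local Open Scope classical_set_scope.
Local Open Scope ring_scope.
Local Open Scope complex_scope.

(* The topology of R[i] is the one carried by every numFieldType, given by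
   its norm; it is declared here so that it is found for the type R[i]. *)
#[non_forgetful_inheritance, warning="-redundant-canonical-projection"]
HB.instance Definition _ (R : rcfType) :=
  PseudoPointedMetric.copy R[i] (R[i])^o.
#[non_forgetful_inheritance, warning="-redundant-canonical-projection"]
HB.instance Definition _ (R : rcfType) := NormedModule.copy R[i] (R[i])^o.

Local Notation Re := complex.Re.
Local Notation Im := complex.Im.
Local Notation normc := ComplexField.Normc.normc.

Section Defs.
Variable R : realType.
Implicit Types (K theta phi x y t : R) (z c : R[i]) (U V A : set R[i]).

Definition nbhs_infty U := exists r : R, [set z | r < normc z] `<=` U.

Definition dense_near_infty A :=
  exists V, nbhs_infty V /\ V `<=` closure (A `&` V).

(* Elements of R / 2 pi Z are handled through real representatives. *)

Definition cis t : R[i] := cos t +i* sin t.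

Definition eq_angle x y := exists k : int, x = y + 2 * pi * k%:~R.

(* Convergence in the quotient R / 2 pi Z: some choice of representatives of
   the u n converges in R. *)
Definition cvg_angle (u : nat -> R) (a : R) :=
  exists v : nat -> R, (forall n, eq_angle (v n) (u n)) /\ v @ \oo --> a.

(* The argument in ]-pi, pi]; only meaningful for z != 0. *)
Definition arg z : R :=
  let a := acos (Re z / normc z) in if 0 <= Im z then a else - a.

(* Derivative at phi of the circle map represented by g. As g may jump by
   multiples of 2 pi, it is read in the chart of the target circle centred at
   g phi, that is, through the representative in ]-pi, pi] of g x - g phi. *)
Definition angle_derive (g : R -> R) phi : R :=
  derive1 (fun x => arg (cis (g x - g phi))) phi.

Definition ray phi : set R[i] :=
  [set z | exists2 t : R, 0 <= t & z = t%:C * cis phi].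

Definition h_aff K theta z : R[i] :=
  ((K + 1) / 2)%:C * z + cis (2 * theta) * ((K - 1) / 2)%:C * conjc z.

Definition H_sq K theta z : R[i] := h_aff K theta z ^+ 2.

Definition f_quad K theta c z : R[i] := H_sq K theta z + c.

Definition Htilde K theta phi : R := arg (H_sq K theta (cis phi)).

Definition fixed_angle K theta phi := eq_angle (Htilde K theta phi) phi.

Definition locally_repelling K theta phi :=
  fixed_angle K theta phi /\ 1 < angle_derive (Htilde K theta) phi.

Definition absolutely_continuous_on (a b : R) (g : R -> R[i]) :=
  forall e : R, 0 < e -> exists2 d : R, 0 < d &
    forall (n : nat) (s t : 'I_n -> R),
      (forall i, [/\ a <= s i, s i <= t i & t i <= b]) ->
      trivIset setT (fun i => [set` `]s i, t i[]) ->
      \sum_(i < n) (t i - s i) < d ->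
      \sum_(i < n) normc (g (t i) - g (s i)) < e.

Definition absolutely_continuous_on_lines U (g : R[i] -> R[i]) :=
  forall a b a' b' : R,
    [set z | a <= Re z <= b /\ a' <= Im z <= b'] `<=` U ->
    {ae @lebesgue_measure R, forall y, a' <= y <= b' ->
       absolutely_continuous_on a b (fun x => g (x +i* y))} /\
    {ae @lebesgue_measure R, forall x, a <= x <= b ->
       absolutely_continuous_on a' b' (fun y => g (x +i* y))}.

Definition dx (g : R[i] -> R[i]) z : R[i] :=
  derive1 (fun x => Re (g (x +i* Im z))) (Re z) +i*
  derive1 (fun x => Im (g (x +i* Im z))) (Re z).

Definition dy (g : R[i] -> R[i]) z : R[i] :=
  derive1 (fun y => Re (g (Re z +i* y))) (Im z) +i*
  derive1 (fun y => Im (g (Re z +i* y))) (Im z).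

Definition dz (g : R[i] -> R[i]) z : R[i] :=
  (dx g z - (0 +i* 1) * dy g z) / 2.

Definition dzbar (g : R[i] -> R[i]) z : R[i] :=
  (dx g z + (0 +i* 1) * dy g z) / 2.

Definition homeomorphism_on U (g : R[i] -> R[i]) :=
  [/\ open U, open (g @` U), {within U, continuous g} &
      exists g' : R[i] -> R[i],
        {in U, cancel g g'} /\ {within g @` U, continuous g'}].

(* The analytic definition of quasiconformality, with k = (K' - 1) / (K' + 1)
   for K'-quasiconformal maps. The partial derivatives in the last clause
   exist almost everywhere in U by absolute continuity on lines. *)
Definition quasiconformal U (g : R[i] -> R[i]) :=
  [/\ homeomorphism_on U g, absolutely_continuous_on_lines U g &
      exists k : R, 0 <= k < 1 /\
        {ae (lebesgue_measure \x lebesgue_measure)%E, forall p : R * R,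
          U (p.1 +i* p.2) ->
          normc (dzbar g (p.1 +i* p.2)) <= k * normc (dz g (p.1 +i* p.2))}].

(* psi is a total function, of which only the values on U matter. *)
Definition bottcher K theta c U (psi : R[i] -> R[i]) :=
  [/\ nbhs_infty U, f_quad K theta c @` U `<=` U & quasiconformal U psi] /\
  [/\ nbhs_infty (psi @` U),
      (forall V, nbhs_infty V -> nbhs_infty (psi @^-1` V)) &
      {in U, forall z, H_sq K theta (psi z) = psi (f_quad K theta c z)}].

Definition external_ray U (psi : R[i] -> R[i]) phi : set R[i] :=
  U `&` psi @^-1` (ray phi `&` psi @` U).

Definition fixed_set K theta c (E : set R[i]) := f_quad K theta c @` E `<=` E.

Definition fixed_external_rays K theta c U psi : set (set R[i]) :=
  [set E | fixed_set K theta c E /\ exists phi, E = external_ray U psi phi].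

Definition basin K theta U psi (phi0 : R) : set R[i] :=
  \bigcup_(phi in [set phi | cvg_angle (fun n => iter n (Htilde K theta) phi)
                                       phi0])
    external_ray U psi phi.

Definition iterated_preimages K theta c (E : set R[i]) : set R[i] :=
  \bigcup_k (iter k (f_quad K theta c) @^-1` E).

End Defs.

(* Main.v *)
Require Import Defs.
From mathcomp Require Import all_boot all_order all_algebra.
From mathcomp Require Import all_classical all_reals all_analysis.
From mathcomp Require Import ring lra.

(** Only the homeomorphism [psi] matters for the topology: it carries external
rays to rays and conjugates [f_quad] to [H_sq], so a dense set of angles gives a
union of external rays that is dense near infinity ([dense_near_infty_rays]).
What has to be proved is that preimages of a fixed angle, or the basin of the
non-repelling fixed angle, are dense for the circle map [Htilde].

This circle map is a quadratic rational map in disguise. Let [a] be a fixed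
angle and [v = cis (a / 2)]. Every angle other than [a] is the direction of
[cis a * (x + i)^2 = (v * (x + i))^2] for one real [x], where [x = 0] is the
angle opposite to [a] and [x = oo] is [a]. Since [h_aff] is real linear and
sends [cis a = v^2] to a real multiple of [v], the map [v w |-> h_aff (v^2 w^2)]
is quadratic in the homogeneous coordinates of [w]. Hence [Htilde] becomes
[F x = l * (x - 1 / x) + b] with [l > 0], and [1 / l] is the derivative of
[Htilde] at [a] ([half_angle_chart], [angle_derive_Htilde]). The remaining fixed
angles are the real zeros of [Q x = (1 - l) * x^2 - b * x + l]
([lift_map_fixed]), with multiplier [l * (1 + 1 / x^2)]
([inv_multiplier_chart]).

The multipliers are read off from this. If [l >= 1], that is, if [a] is not
repelling, then every other multiplier exceeds 1. If [l < 1] and [Q] has real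
zeros, their product is [l / (1 - l)], and at the zero of larger absolute value
the multiplier is at most 1 ([exists_nonrepelling]).

Density is an expansion argument. Let [G] contain the pole 0 and all points that
[F] sends into [G]. A gap, that is, an interval [[x, y]] that misses [G], lies
on one side of 0, [F] maps it onto the interval [[F x, F y]], which is again a
gap, and [F y - F x = l * (1 + 1 / (x * y)) * (y - x)]. In each case the images
grow beyond a bound that they must respect ([no_expanding_family]).
- If [a] is the only fixed angle and [l < 1], then [Q] has no real zero. It has a
  zero [p + i q] in the upper half plane, and [F] uniformly expands the
  measure [d atan ((x - p) / q)], of total mass [pi] ([dense_elliptic]).
- If [a] is the only fixed angle and [l >= 1], then [l = 1] and [b = 0]. This is
  Boole's map [x - 1 / x]; it moves intervals towards 0, and at least doubles
  the length of a gap contained in [[-1, 1]] ([dense_boole]).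
- If [a] is non-repelling and not the only fixed angle, then [l > 1], or [l = 1]
  and [b] is nonzero. For [l > 1] all points far from 0 escape to infinity, so
  intervals that miss the basin stay bounded while [l] expands them
  ([dense_hyperbolic]). For [l = 1] the same holds on the side to which the
  translation by [b] pushes, and intervals on the other side drift across 0
  ([dense_parabolic]). *)

Import Order.TTheory GRing.Theory Num.Theory.
Import numFieldNormedType.Exports.
Local Open Scope classical_set_scope.
Local Open Scope card_scope.
Local Open Scope ring_scope.

Set Implicit Arguments.
Unset Strict Implicit.
Unset Printing Implicit Defensive.

(** * Dense backward orbits of the map l * (x - 1 / x) + b *)

(** The circle map [Htilde] in the half-angle chart at one of its fixed angles: the
point at infinity is that fixed angle, and the pole 0 is the opposite angle. *)
Definition lift_map {R : realType} (l b x : R) : R := l * (x - x^-1) + b.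

(** The pole 0 is mapped to infinity, so it plays the part of a first preimage of
the fixed angle at infinity. *)
Definition backward_closed {R : realType} (l b : R) (G : R -> Prop) :=
  G 0 /\ forall x, x != 0 -> G (lift_map l b x) -> G x.

Definition gap {R : realType} (G : R -> Prop) (x y : R) :=
  x < y /\ forall z, x <= z <= y -> ~ G z.

Definition dense_in_line {R : realType} (G : R -> Prop) :=
  forall x y : R, x < y -> exists2 z, x <= z <= y & G z.

Lemma dense_of_no_gap (R : realType) (G : R -> Prop) :
  (forall x y, ~ gap G x y) -> dense_in_line G.
Proof.
move=> ng x y xy; apply: contrapT => h; apply: (ng x y); split => // z zxy Gz.
by apply: h; exists z.
Qed.

(** An exact formula for the change of length, so that no derivative is needed to
follow intervals. *)
Lemma lift_map_diff (R : realType) (l b x y : R) : x != 0 -> y != 0 ->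
  lift_map l b y - lift_map l b x = l * (1 + (x * y)^-1) * (y - x).
Proof. by move=> x0 y0; rewrite /lift_map; field; rewrite x0 y0. Qed.

(** A gap cannot contain 0, so [lift_map] is continuous and increasing on it; by the
intermediate value theorem its image is the whole interval between the images of
the endpoints, and backward invariance of [G] keeps that interval away from [G]. *)
Lemma gap_step (R : realType) (l b : R) (G : R -> Prop) (x y : R) :
  0 < l -> backward_closed l b G -> gap G x y ->
  0 < x * y /\ gap G (lift_map l b x) (lift_map l b y).
Proof.
move=> l0 [G0 GF] [xy Gxy].
have n0 z : x <= z <= y -> z != 0.
  by move=> zxy; apply/eqP => z0; apply: (Gxy z zxy); rewrite z0.
have xy0 : 0 < x * y.
  rewrite ltNge; apply/negP => h; suff /n0 : x <= 0 <= y by rewrite eqxx.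
  by apply/andP; split; nra.
have x0 : x != 0 by apply: n0; rewrite lexx ltW.
have y0 : y != 0 by apply: n0; rewrite lexx ltW.
split=> //; split.
  rewrite -subr_gt0 lift_map_diff// pmulr_lgt0 ?subr_gt0//.
  by rewrite mulr_gt0// addr_gt0// invr_gt0.
have FF : lift_map l b x <= lift_map l b y.
  rewrite -subr_ge0 lift_map_diff// mulr_ge0 ?subr_ge0 ?(ltW xy)//.
  by rewrite mulr_ge0 ?(ltW l0)// addr_ge0// invr_ge0 ltW.
move=> z zF.
have [||w wxy <-] := @IVT R (lift_map l b) x y z (ltW xy).
- apply: continuous_in_subspaceT => w; rewrite inE/= in_itv/= => /n0 w0.
  apply: cvgD; last exact: cvg_cst.
  apply: cvgM; first exact: cvg_cst.
  by apply: cvgB => //; exact: cvgV.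
- by rewrite min_l// max_r.
- move: wxy; rewrite in_itv/= => wxy /(GF _ (n0 _ wxy)); exact: Gxy.
Qed.

(** The common end of all density arguments: a bounded size cannot be multiplied by
a factor larger than 1 again and again. The growth is bounded below linearly,
through Bernoulli's inequality. *)
Lemma no_expanding_family (R : realType) (W : R -> R -> Prop)
    (len : R -> R -> R) (rho M : R) : 1 < rho ->
  (forall x y, W x y -> 0 < len x y <= M /\
     exists x' y', W x' y' /\ rho * len x y <= len x' y') ->
  forall x y, ~ W x y.
Proof.
move=> rho1 hW x y Wxy.
have grow n : exists x' y', W x' y' /\ (1 + n%:R * (rho - 1)) * len x y <= len x' y'.
  elim: n => [|n [x1 [y1 [W1 h1]]]].
    by exists x, y; split => //; rewrite mul0r addr0 mul1r.
  have [_ [x2 [y2 [W2 h2]]]] := hW _ _ W1.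
  exists x2, y2; split => //; apply: le_trans h2.
  have [/andP[L0 _] _] := hW _ _ Wxy.
  rewrite -natr1; have n0 : 0 <= n%:R :> R by [].
  have := ler_wpM2l (ltW (lt_trans ltr01 rho1)) h1.
  have : 0 <= n%:R * (rho - 1) ^+ 2 * len x y.
    by rewrite (mulr_ge0 _ (ltW L0))// mulr_ge0 ?sqr_ge0.
  lra.
have [/andP[L0 L1] _] := hW _ _ Wxy.
have M0 : 0 <= M by lra.
have r0 : 0 < (rho - 1) * len x y by nra.
have [x1 [y1 [W1 h1]]] := grow (Num.bound (M / ((rho - 1) * len x y))).
have [/andP[_ LM] _] := hW _ _ W1.
have := archi_boundP (divr_ge0 M0 (ltW r0)).
by rewrite ltr_pdivrMr//; nra.
Qed.

(** The inequality on [b] says that [Q z = (1 - l) * z^2 - b * z + l] has no real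
zero. Its zero [p + i q] in the upper half plane is a fixed point of
[lift_map l b], which maps that half plane into itself; [T] measures intervals
by the harmonic measure seen from [p + i q]. The density of [T] is
[q * (1 - l) / Q], and the identity
[Q (F z) = Q z * l * (z^2 + 1 - Q z) / z^2] shows that [F] expands it by
[(z^2 + 1) / (z^2 + 1 - Q z)], which exceeds [1 + d] as soon as
[d * (z^2 + 1) <= Q z]. *)
Lemma dense_elliptic (R : realType) (l b : R) (G : R -> Prop) :
  0 < l < 1 -> b ^+ 2 < 4 * l * (1 - l) ->
  backward_closed l b G -> dense_in_line G.
Proof.
move=> /andP[l0 l1] disc bc; apply: dense_of_no_gap.
(* [d] is a quarter of minus the discriminant of [Q]. The discriminant of
   [Q z - d * (z ^+ 2 + 1)] is [- 4 * d ^+ 2], so [Qd] below holds. *)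
pose d := l * (1 - l) - b ^+ 2 / 4.
have d0 : 0 < d by rewrite /d; lra.
pose Q (z : R) : R := (1 - l) * z ^+ 2 - b * z + l.
have Qd (z : R) : d * (z ^+ 2 + 1) <= Q z.
  have d1 : d < 1 - l by rewrite /d; nra.
  have : 0 <= 4 * (1 - l - d) * (Q z - d * (z ^+ 2 + 1)).
    have -> : 4 * (1 - l - d) * (Q z - d * (z ^+ 2 + 1)) =
      (2 * (1 - l - d) * z - b) ^+ 2 + 4 * d ^+ 2.
      by rewrite /Q /d; field.
    by rewrite addr_ge0 ?sqr_ge0// mulr_ge0 ?sqr_ge0.
  by rewrite pmulr_rge0 ?subr_ge0// mulr_gt0// subr_gt0.
pose p := b / (2 * (1 - l)).
pose q := Num.sqrt (l / (1 - l) - p ^+ 2).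
have l1' : 0 < 1 - l by lra.
have q20 : 0 < l / (1 - l) - p ^+ 2.
  have -> : l / (1 - l) - p ^+ 2 = d / (1 - l) ^+ 2 by rewrite /d /p; field; lra.
  by rewrite divr_gt0// exprn_gt0.
have q0 : 0 < q by rewrite sqrtr_gt0.
have q2 : q ^+ 2 = l / (1 - l) - p ^+ 2 by rewrite sqr_sqrtr// ltW.
have QE (z : R) : Q z = (1 - l) * ((z - p) ^+ 2 + q ^+ 2).
  by rewrite q2 /Q /p; field; lra.
pose T (z : R) : R := atan ((z - p) / q).
have dT (z : R) : is_derive z 1 T (q * (1 - l) / Q z).
  have -> : q * (1 - l) / Q z = (1 + ((z - p) / q) ^+ 2)^-1 * q^-1.
    have h : 0 < (z - p) ^+ 2 + q ^+ 2 by rewrite ltr_wpDl ?sqr_ge0 ?exprn_gt0.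
    rewrite QE; field; repeat (apply/andP; split); rewrite ?gt_eqF//.
    by rewrite addrC.
  have : is_derive z 1 (fun z => (z - p) / q) q^-1.
    have -> : (fun z => (z - p) / q) = q^-1 \*: (id - cst p).
      by apply/funext => u /=; rewrite mulrC.
    by apply: is_derive_eq; rewrite subr0 /GRing.scale/= mulr1.
  by move=> h; apply: is_derive1_comp.
have dF (z : R) : z != 0 -> is_derive z 1 (lift_map l b) (l * (1 + z ^- 2)).
  move=> z0.
  have -> : lift_map l b = l \*: (id - (fun y => y^-1)) + cst b.
    by apply/funext => u.
  have := @is_deriveV R id z 1 1 z0 _.
  move=> h; apply: is_derive_eq; rewrite addr0 /GRing.scale/= mulr1 opprK//.
apply: (@no_expanding_family _ (gap G) (fun x y => T y - T x) (1 + d) pi).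
  by rewrite ltrDl.
move=> x y gxy; have [xy _] := gxy; split.
  have T0 : T x < T y by apply: lt_atan; rewrite ltr_pM2r ?invr_gt0// ltrD2r.
  rewrite subr_gt0 T0/=.
  have := atan_ltpi2 ((y - p) / q); have := atan_gtNpi2 ((x - p) / q).
  rewrite -/(T x) -/(T y); lra.
have [xy0 gF] := gap_step l0 bc gxy.
exists (lift_map l b x), (lift_map l b y); split => //.
have n0 z : x <= z <= y -> z != 0 by move=> zxy; apply/eqP => z0; nra.
(* [k'] is the derivative of [T (F z) - (1 + d) * T z] *)
pose k' (z : R) : R := q * (1 - l) / Q (lift_map l b z) * (l * (1 + z ^- 2)) -
  (1 + d) * (q * (1 - l) / Q z).
pose k := (T \o lift_map l b - (1 + d) \*: T) : R -> R.
have dk (z : R) : x <= z <= y ->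
    is_derive z 1 k (k' z).
  by move=> /n0 z0; have := dF z z0 => h; exact: is_deriveB.
have [||c cxy E] := @MVT_segment R k k' x y (ltW xy).
- by move=> z; rewrite in_itv/= => /andP[? ?]; apply: dk; rewrite !ltW.
- apply: derivable_within_continuous => z; rewrite in_itv/= => /dk h.
  exact: ex_derive.
move: cxy; rewrite in_itv/= => /n0 c0.
suff : 0 <= k' c.
  move=> kc; have : 0 <= k' c * (y - x) by rewrite mulr_ge0// subr_ge0 ltW.
  rewrite -E.
  change (k y - k x) with (T (lift_map l b y) - (1 + d) * T y -
    (T (lift_map l b x) - (1 + d) * T x)); lra.
have Qc : 0 < Q c.
  by apply: lt_le_trans (Qd c); rewrite mulr_gt0// ltr_wpDl ?sqr_ge0.
pose S := c ^+ 2 + 1 - Q c.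
have QF : Q (lift_map l b c) = Q c * (l * S / c ^+ 2).
  by rewrite /S /Q /lift_map; field.
have c2 : 0 < c ^+ 2 by rewrite lt_neqAle eq_sym sqrf_eq0 c0 sqr_ge0.
have S0 : 0 < S.
  have : 0 < Q (lift_map l b c).
    by apply: lt_le_trans (Qd _); rewrite mulr_gt0// ltr_wpDl ?sqr_ge0.
  by rewrite QF pmulr_rgt0// pmulr_lgt0 ?invr_gt0// pmulr_rgt0.
have -> : k' c = q * (1 - l) / Q c / S * (c ^+ 2 + 1 - (1 + d) * S).
  rewrite /k' QF; field; repeat (apply/andP; split); rewrite ?c0 ?gt_eqF//.
apply: mulr_ge0; first by rewrite !divr_ge0 ?ltW// mulr_gt0.
have := Qd c; rewrite /S => h; have : 0 <= d ^+ 2 * (c ^+ 2 + 1).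
  by rewrite mulr_ge0 ?sqr_ge0// addr_ge0// ltW.
by have := ler_wpM2l (ltW d0) h; lra.
Qed.

(** Gaps lie in [[-M, M]], while each step multiplies their length by
[l * (1 + 1 / (x * y)) > l]. *)
Lemma dense_hyperbolic (R : realType) (l b M : R) (G : R -> Prop) :
  1 < l -> (forall x, M < `|x| -> G x) ->
  backward_closed l b G -> dense_in_line G.
Proof.
move=> l1 hM bc; apply: dense_of_no_gap.
apply: (@no_expanding_family _ (gap G) (fun x y => y - x) l (2 * M)) => //.
have bd x : ~ G x -> `|x| <= M by rewrite leNgt => nG; apply/negP => /hM.
move=> x y gxy; have [xy nG] := gxy; split.
  have /bd : ~ G x by apply: nG; rewrite lexx ltW.
  have /bd : ~ G y by apply: nG; rewrite lexx ltW.
  by rewrite !ler_norml; lra.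
have [xy0 gF] := gap_step (lt_trans ltr01 l1) bc gxy.
exists (lift_map l b x), (lift_map l b y); split=> //.
rewrite lift_map_diff; try by apply/eqP => e; move: xy0; rewrite e; lra.
rewrite ler_pM2r ?subr_gt0// ler_peMr ?lerDl ?invr_ge0 ?(ltW xy0)//.
by apply: ltW; apply: lt_trans l1.
Qed.

(** Gaps on the positive side lie in [[0, M]], where the expansion factor is at
least [1 + 1 / M^2]. A gap on the negative side only gets longer while it drifts
to the right, and it reaches the positive side after finitely many steps.
Considering the successive visits to the positive side gives uniform expansion. *)
Lemma dense_parabolic_gt0 (R : realType) (b M : R) (G : R -> Prop) :
  0 < b -> (forall x, M < x -> G x) ->
  backward_closed 1 b G -> dense_in_line G.
Proof.
move=> b0 hM bc; apply: dense_of_no_gap.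
have bd x : ~ G x -> x <= M by rewrite leNgt => nG; apply/negP => /hM.
have step x y : gap G x y -> gap G (lift_map 1 b x) (lift_map 1 b y) /\
   lift_map 1 b y - lift_map 1 b x = (1 + (x * y)^-1) * (y - x) /\
   0 < x * y.
  move=> gxy; have [xy0 gF] := gap_step ltr01 bc gxy; split=> //.
  rewrite lift_map_diff ?mul1r//; apply/eqP => e; move: xy0; rewrite e; lra.
(* [n] bounds the number of steps spent on the negative side *)
have pos n x y : gap G x y -> - y <= n%:R * b ->
    exists x' y', [/\ gap G x' y', 0 < x' & y - x <= y' - x'].
  elim: n x y => [|n IH] x y gxy yn; have [gF [E xy0]] := step _ _ gxy;
    have [xy _] := gxy.
    by exists x, y; split=> //; nra.
  have [x0|x0] := ltP 0 x; first by exists x, y.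
  have y0 : y < 0 by nra.
  have [|x1 [y1 [g1 x10 h1]]] := IH _ _ gF.
    rewrite /lift_map mul1r.
    have : y^-1 < 0 by rewrite invr_lt0.
    by move: yn; rewrite -natr1; lra.
  exists x1, y1; split=> //; apply: le_trans h1; rewrite E.
  by rewrite ler_peMl ?subr_ge0 ?(ltW xy)// lerDl invr_ge0 ltW.
have pos' x y : gap G x y ->
    exists x' y', [/\ gap G x' y', 0 < x' & y - x <= y' - x'].
  move=> gxy; apply: (pos (Num.bound (`|y| / b)) _ _ gxy).
  have := archi_boundP (divr_ge0 (normr_ge0 y) (ltW b0)).
  by rewrite ltr_pdivrMr//; have := ler_norm (- y); rewrite normrN; lra.
move=> x y gxy; have [x1 [y1 [g1 x10 _]]] := pos' _ _ gxy.
have M0 : 0 < M by have [? nG] := g1; have := bd y1 (nG _ _); rewrite lexx ltW//=; lra.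
apply: (@no_expanding_family _ (fun x y => gap G x y /\ 0 < x)
  (fun x y => y - x) (1 + M ^- 2) M _ _ x1 y1) => //.
  by rewrite ltrDl invr_gt0 exprn_gt0.
move=> {g1 x10 gxy x1 y1 x}u {y}v [g u0]; have [uv nG] := g.
have /bd vM : ~ G v by apply: nG; rewrite lexx ltW.
split; first by apply/andP; split; lra.
have [gF [E uv0]] := step _ _ g.
have [x' [y' [g' x'0 h']]] := pos' _ _ gF.
exists x', y'; split => //; apply: le_trans h'; rewrite E.
rewrite ler_pM2r ?subr_gt0// lerD2l lef_pV2 ?posrE ?exprn_gt0// expr2.
by apply: ler_pM; lra.
Qed.

Lemma backward_closed_opp (R : realType) (l b : R) (G : R -> Prop) :
  backward_closed l b G -> backward_closed l (- b) (fun x => G (- x)).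
Proof.
move=> [G0 GF]; split; first by rewrite oppr0.
move=> x x0 GFx; apply: GF; rewrite ?oppr_eq0//.
by have -> : lift_map l b (- x) = - lift_map l (- b) x
  by rewrite /lift_map invrN; ring.
Qed.

Lemma dense_in_line_opp (R : realType) (G : R -> Prop) :
  dense_in_line (fun x => G (- x)) -> dense_in_line G.
Proof.
move=> dG x y xy; have [z zxy Gz] := dG (- y) (- x) (ltac:(by rewrite ltrN2)).
by exists (- z) => //; rewrite lerNl lerNr andbC.
Qed.

(** The sign of [b] says to which side the map pushes; conjugating with
[x |-> - x] reduces to [b > 0]. *)
Lemma dense_parabolic (R : realType) (b M : R) (G : R -> Prop) :
  b != 0 -> (forall x, M < Num.sg b * x -> G x) ->
  backward_closed 1 b G -> dense_in_line G.
Proof.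
move=> b0 hM bc; have [bn|bp|] := ltgtP b 0; last by move/eqP; rewrite (negbTE b0).
  apply: dense_in_line_opp; apply: (@dense_parabolic_gt0 _ (- b) M).
  - by rewrite oppr_gt0.
  - by move=> x Mx; apply: hM; rewrite ltr0_sg// mulrNN mul1r.
  - exact: backward_closed_opp.
apply: (@dense_parabolic_gt0 _ b M) => // x Mx.
by apply: hM; rewrite gtr0_sg// mul1r.
Qed.

Lemma boole_gap_step (R : realType) (G : R -> Prop) (x y : R) :
  backward_closed 1 0 G -> gap G x y ->
  [/\ 0 < x * y, gap G (x - x^-1) (y - y^-1) &
      (y - y^-1) - (x - x^-1) = (1 + (x * y)^-1) * (y - x)].
Proof.
move=> bc gxy; have [xy0] := gap_step ltr01 bc gxy.
have := @lift_map_diff R 1 0 x y.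
rewrite /lift_map !mul1r !addr0 => E gF; split=> //.
by apply: E; apply/eqP => e; move: xy0; rewrite e; lra.
Qed.

(** A gap [[u, v]] with [1 < v <= Y] moves towards 0 by at least [1 / Y] at each
step, without getting shorter and without crossing 0: its new right end
[v - 1 / v] is still positive. *)
Lemma boole_gap_descent_gt0 (R : realType) (G : R -> Prop) (x y : R) :
  backward_closed 1 0 G -> gap G x y -> 0 < x ->
  exists x' y', [/\ gap G x' y', 0 < x', y' <= 1 & y - x <= y' - x'].
Proof.
move=> bc; set Y := y => gxy x0.
have Y0 : 0 < Y by have [] := gxy; rewrite /Y; lra.
suff H n u v : gap G u v -> 0 < u -> v <= Y -> v <= 1 + n%:R * Y^-1 ->
    exists x' y', [/\ gap G x' y', 0 < x', y' <= 1 & v - u <= y' - x'].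
  apply: (H (Num.bound (Y / Y^-1)) _ _ gxy) => //.
  have Yi : 0 < Y^-1 by rewrite invr_gt0.
  have := archi_boundP (divr_ge0 (ltW Y0) (ltW Yi)).
  by rewrite ltr_pdivrMr//; lra.
elim: n u v => [|n IH] u v guv u0 vY; rewrite ?mul0r ?addr0 => vn.
  by exists u, v.
have [v1|v1] := leP v 1; first by exists u, v.
have [uv _] := guv.
have [uv0 gF E] := boole_gap_step bc guv.
have v0 : 0 < v by lra.
have vV1 : v^-1 < 1 by rewrite invf_lt1.
have vVY : Y^-1 <= v^-1 by rewrite lef_pV2 ?posrE.
have vV0 : 0 < v^-1 by rewrite invr_gt0.
have [FF0 _ _] := boole_gap_step bc gF.
have [| | |x1 [y1 [g1 x10 y11 h1]]] := IH _ _ gF.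
- have FF1 : 0 < v - v^-1 by lra.
  by rewrite -(pmulr_lgt0 _ FF1).
- by lra.
- by move: vn; rewrite -natr1; lra.
exists x1, y1; split => //; apply: le_trans h1; rewrite E.
by rewrite ler_peMl ?subr_ge0 ?(ltW uv)// lerDl invr_ge0 ltW.
Qed.

(** A gap on the negative side is the mirror image of a gap on the positive side for
the reflected set, since Boole's map is odd. *)
Lemma boole_gap_descent (R : realType) (G : R -> Prop) (x y : R) :
  backward_closed 1 0 G -> gap G x y ->
  exists x' y', [/\ gap G x' y', -1 <= x', y' <= 1 & y - x <= y' - x'].
Proof.
move=> bc gxy; have [xy0 _ _] := boole_gap_step bc gxy; have [xy nG] := gxy.
have [x0|x0] := ltP 0 x.
  have [x' [y' [g' x'0 y'1 h]]] := boole_gap_descent_gt0 bc gxy x0.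
  by exists x', y'; split; [exact: g'|lra|lra|exact: h].
have bcN := backward_closed_opp bc; rewrite oppr0 in bcN.
have gN : gap (fun x => G (- x)) (- y) (- x).
  by split=> [|z zxy]; [rewrite ltrN2|apply: nG; rewrite lerNr lerNl andbC].
have [|x' [y' [[xy' nG'] x'0 y'1 h]]] := boole_gap_descent_gt0 bcN gN.
  by nra.
exists (- y'), (- x'); split; [split|lra|lra|lra].
  by rewrite ltrN2.
by move=> z zxy; rewrite -[z]opprK; apply: nG'; rewrite lerNr lerNl andbC.
Qed.

(** A gap inside [[-1, 1]] is at least doubled by the map, because [x * y <= 1]
there; the image may leave [[-1, 1]], but descends back to it without loss of
length. *)
Lemma dense_boole (R : realType) (G : R -> Prop) :
  backward_closed 1 0 G -> dense_in_line G.
Proof.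
move=> bc; apply: dense_of_no_gap => x y gxy.
have [x1 [y1 [g1 x1N1 y11 _]]] := boole_gap_descent bc gxy.
apply: (@no_expanding_family _ (fun x y => [/\ gap G x y, -1 <= x & y <= 1])
  (fun x y => y - x) 2 2 _ _ x1 y1) => //; first by rewrite ltr1n.
move=> {g1 x1N1 y11 gxy x1 y1 x}u {y}v [g u0 v0]; have [uv nG] := g.
split; first by apply/andP; split; lra.
have [uv0 gF E] := boole_gap_step bc g.
have [x' [y' [g' x'1 y'1 h']]] := boole_gap_descent bc gF.
exists x', y'; split => //; apply: le_trans h'; rewrite E.
have uv1 : u * v <= 1 by nra.
have : 1 <= (u * v)^-1 by rewrite invf_ge1.
by move=> h; rewrite ler_pM2r ?subr_gt0//; lra.
Qed.

(** * Angles and polar coordinates *)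

Local Open Scope complex_scope.
Local Notation Re := complex.Re.
Local Notation Im := complex.Im.
Local Notation normc := ComplexField.Normc.normc.

Lemma mulcE (R : realType) (a b c d : R) :
  (a +i* b) * (c +i* d) = (a * c - b * d) +i* (a * d + b * c).
Proof. by []. Qed.

Lemma complex_ext (R : realType) (z w : R[i]) :
  Re z = Re w -> Im z = Im w -> z = w.
Proof. by case: z w => [a b] [c d] /= -> ->. Qed.

Lemma normc_sqrt (R : realType) (z : R[i]) : normc z = Num.sqrt (Re z ^+ 2 + Im z ^+ 2).
Proof. by case: z. Qed.

Lemma normc_ge0 (R : realType) (z : R[i]) : 0 <= normc z.
Proof. by rewrite normc_sqrt sqrtr_ge0. Qed.

Lemma normc_gt0 (R : realType) (z : R[i]) : (0 < normc z) = (z != 0).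
Proof.
rewrite lt_neqAle normc_ge0 andbT eq_sym; congr (~~ _); apply/eqP/eqP.
  exact: ComplexField.Normc.eq0_normc.
by move->; exact: ComplexField.Normc.normc0.
Qed.

Lemma normc_real (R : realType) (r : R) : normc r%:C = `|r|.
Proof. by rewrite normc_sqrt /= expr0n /= addr0 sqrtr_sqr. Qed.

Lemma cisD (R : realType) (a b : R) : cis (a + b) = cis a * cis b.
Proof.
by rewrite /cis mulcE cosD sinD; apply: complex_ext => /=; rewrite addrC// addrC.
Qed.

Lemma cis0 (R : realType) : cis (0 : R) = 1.
Proof. by rewrite /cis cos0 sin0. Qed.

Lemma normc_cis (R : realType) (a : R) : normc (cis a) = 1.
Proof. by rewrite normc_sqrt /= cos2Dsin2 sqrtr1. Qed.

Lemma cis_neq0 (R : realType) (a : R) : cis a != 0.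
Proof. by rewrite -normc_gt0 normc_cis. Qed.

Lemma cis_period (R : realType) (k : int) : cis (2 * pi * k%:~R : R) = 1.
Proof.
have nat n : cis (2 * pi * n%:R : R) = 1.
  elim: n => [|n IH]; first by rewrite mulr0 cis0.
  rewrite -(natr1 n) mulrDr mulr1 cisD IH mul1r /cis mulr_natl.
  by rewrite cos2pi sin2pi.
case: k => n; first exact: nat.
rewrite NegzE mulrNz mulrN; apply: (mulfI (cis_neq0 (2 * pi * n.+1%:R))).
by rewrite -cisD subrr cis0 mulr1 nat.
Qed.

(** The difference of the two angles, reduced to [[0, 2 pi[], has cosine 1, and
the cosine is injective on [[0, pi]]. *)
Lemma cis_eq_angle (R : realType) (a b : R) : cis a = cis b <-> eq_angle a b.
Proof.
split; last by move=> [k ->]; rewrite cisD cis_period mulr1.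
move=> ab; pose k := Num.floor ((a - b) / (2 * pi)).
exists k; pose t := a - b - 2 * pi * k%:~R.
have pi0 := pi_gt0 R.
have pi20 : 0 < 2 * pi :> R by lra.
have ct : cis t = 1.
  apply: (mulfI (cis_neq0 (b + 2 * pi * k%:~R))); rewrite -cisD.
  have -> : b + 2 * pi * k%:~R + t = a by rewrite /t; ring.
  by rewrite cisD cis_period !mulr1.
have /andP[k0 k1] := floor_itv ((a - b) / (2 * pi)).
have t0 : 0 <= t by rewrite /t subr_ge0 mulrC -ler_pdivlMr.
have t1 : t < 2 * pi.
  by move: k1; rewrite -/k ltr_pdivrMr// intrD /t; lra.
suff : t = 0 by rewrite /t; lra.
have [ct1 st1] : cos t = 1 /\ sin t = 0 by case: ct.
have [tpi|tpi] := leP t pi.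
  by apply: cos_inj; rewrite ?in_itv/= ?cos0 ?t0 ?lexx//= ltW.
have : 2 * pi - t = 0.
  apply: cos_inj; rewrite ?in_itv/= ?lexx ?(ltW pi0)//; first by lra.
  by rewrite mulr_natl addrC cosD2pi cosN ct1 cos0.
lra.
Qed.

Lemma normcR_mul (R : realType) (r : R) (z : R[i]) : 0 <= r ->
  normc (r%:C * z) = r * normc z.
Proof. by move=> r0; rewrite ComplexField.Normc.normcM normc_real ger0_norm. Qed.

Lemma arg_polar (R : realType) (r a : R) : 0 < r -> - pi < a <= pi ->
  arg (r%:C * cis a) = a.
Proof.
move=> r0 /andP[apiN api].
rewrite /arg normcR_mul ?(ltW r0)// normc_cis mulr1 /cis mulcE /= !mul0r subr0 addr0.
rewrite mulrAC divff ?gt_eqF// mul1r pmulr_rge0//.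
have [a0|a0] := leP 0 a.
  by rewrite sin_ge0_pi ?a0//= cosK// in_itv/= a0.
rewrite ifN ?cosKN ?opprK//; first by rewrite !ltW.
rewrite -ltNge -oppr_gt0 -sinN sin_gt0_pi//; lra.
Qed.

Lemma polar_decomposition (R : realType) (z : R[i]) : z != 0 ->
  z = (normc z)%:C * cis (arg z).
Proof.
rewrite -normc_gt0 => n0; set n := normc z in n0 *.
have n2 : Re z ^+ 2 + Im z ^+ 2 = n ^+ 2.
  by rewrite /n normc_sqrt sqr_sqrtr// addr_ge0 ?sqr_ge0.
pose x := Re z / n.
have x2 : x ^+ 2 = 1 - (Im z / n) ^+ 2.
  have : x ^+ 2 + (Im z / n) ^+ 2 = 1.
    by rewrite /x !expr_div_n -mulrDl n2 divff// expf_neq0// gt_eqF.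
  lra.
have x1 : -1 <= x <= 1.
  by have := sqr_ge0 (Im z / n) => h; apply/andP; split; nra.
have sx : sin (acos x) = `|Im z| / n.
  rewrite sin_acos// x2 opprB addrC subrK sqrtr_sqr normrM.
  by rewrite (ger0_norm (_ : 0 <= n^-1)) ?invr_ge0 ?ltW.
rewrite /arg -/n -/x /cis mulcE !mul0r subr0 addr0.
have cx : n * x = Re z by rewrite /x; field; rewrite gt_eqF.
have [I0|I0] := leP 0 (Im z); apply: complex_ext => /=;
  rewrite ?cosN ?acosK ?in_itv// ?sinN sx.
- by rewrite ger0_norm//; field; rewrite gt_eqF.
- by rewrite ltr0_norm//; field; rewrite gt_eqF.
Qed.

(** * The circle map in the half-angle chart at a fixed angle *)

Definition same_dir {R : realType} (z w : R[i]) :=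
  exists2 r : R, 0 < r & z = r%:C * w.

Lemma same_dir_sym (R : realType) (z w : R[i]) : same_dir z w -> same_dir w z.
Proof.
move=> [r r0 ->]; exists r^-1; first by rewrite invr_gt0.
by rewrite mulrA -rmorphM /= mulVf ?gt_eqF// mul1r.
Qed.

Lemma same_dir_trans (R : realType) (z w u : R[i]) :
  same_dir z w -> same_dir w u -> same_dir z u.
Proof.
move=> [r r0 ->] [s s0 ->]; exists (r * s); first exact: mulr_gt0.
by rewrite mulrA -rmorphM.
Qed.

Lemma same_dir_cis (R : realType) (a b : R) :
  same_dir (cis a) (cis b) -> eq_angle a b.
Proof.
move=> [r r0 E]; apply/cis_eq_angle; rewrite E.
have := congr1 (fun z => normc z) E.
by rewrite normcR_mul ?(ltW r0)// !normc_cis mulr1 => <-; rewrite mul1r.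
Qed.

Lemma same_dir_arg (R : realType) (z : R[i]) : z != 0 -> same_dir (cis (arg z)) z.
Proof.
move=> z0; apply: same_dir_sym; exists (normc z); first by rewrite normc_gt0.
exact: polar_decomposition.
Qed.

Lemma h_affD (R : realType) (K theta : R) (z w : R[i]) :
  h_aff K theta (z + w) = h_aff K theta z + h_aff K theta w.
Proof. by rewrite /h_aff rmorphD /=; ring. Qed.

Lemma h_affZ (R : realType) (K theta r : R) (z : R[i]) :
  h_aff K theta (r%:C * z) = r%:C * h_aff K theta z.
Proof.
rewrite /h_aff; have -> : conjc (r%:C * z) = r%:C * conjc z; last by ring.
by rewrite -{2}[r%:C]conjc_real; exact: (rmorphM (@conjc R)).
Qed.

Lemma H_sqZ (R : realType) (K theta r : R) (z : R[i]) :
  H_sq K theta (r%:C * z) = (r ^+ 2)%:C * H_sq K theta z.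
Proof. by rewrite /H_sq h_affZ rmorphXn/=; ring. Qed.

(** For a real linear map of the plane this is the determinant: the signed area of
the image of the positive orthonormal basis [cis a, i * cis a]. *)
Lemma h_aff_jacobian (R : realType) (K theta a : R) :
  Im (conjc (h_aff K theta (cis a)) * h_aff K theta ((0 +i* 1) * cis a)) = K.
Proof.
rewrite /h_aff /cis /=.
have := cos2Dsin2 a; have := cos2Dsin2 (2 * theta).
move: (cos a) (sin a) (cos (2 * theta)) (sin (2 * theta)) => c s C S hC hc.
rewrite ?mulcE /=.
transitivity ((((K + 1) / 2) ^+ 2 - ((K - 1) / 2) ^+ 2 * (C ^+ 2 + S ^+ 2)) *
  (c ^+ 2 + s ^+ 2)); first by ring.
by rewrite hC hc; field.
Qed.

Lemma H_sq_cis_neq0 (R : realType) (K theta a : R) :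
  1 < K -> H_sq K theta (cis a) != 0.
Proof.
move=> K1; rewrite sqrf_eq0; apply/eqP => h0.
have := h_aff_jacobian K theta a; rewrite h0 conjc0 mul0r /= => K0.
by move: K1; rewrite -K0 ltr10.
Qed.

Lemma same_dir_Htilde (R : realType) (K theta a : R) : 1 < K ->
  same_dir (cis (Htilde K theta a)) (H_sq K theta (cis a)).
Proof. by move=> K1; apply: same_dir_arg; exact: H_sq_cis_neq0. Qed.

(** The reciprocal of the derivative of the circle map at [a]. That derivative is
twice the determinant [K] of the linear map [h_aff] divided by the squared norm
of [h_aff (cis a)], which is the norm of [H_sq (cis a)]. *)
Definition inv_multiplier {R : realType} (K theta a : R) : R :=
  normc (H_sq K theta (cis a)) / (2 * K).

Lemma inv_multiplier_gt0 (R : realType) (K theta a : R) : 1 < K ->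
  0 < inv_multiplier K theta a.
Proof.
move=> K1; rewrite divr_gt0 ?normc_gt0 ?H_sq_cis_neq0// mulr_gt0//.
exact: lt_trans K1.
Qed.

(** [H_sq] in homogeneous half-angle coordinates: the direction [[s : t]] is sent to
[[l * (s^2 - t^2) + b * s * t : s * t]], that is, [s / t] is sent to
[lift_map l b (s / t)]. *)
Definition half_angle_normal_form {R : realType} (K theta a b : R) :=
  forall s t : R, H_sq K theta (cis a * (s +i* t) ^+ 2) =
    (2 * K / inv_multiplier K theta a)%:C *
    (cis a * ((inv_multiplier K theta a * (s ^+ 2 - t ^+ 2) + b * s * t)
              +i* (s * t)) ^+ 2).

(** With [v = cis (a / 2)], being fixed means that [h_aff (v^2) = kap * v] for a real
[kap], positive or negative. If [h_aff (i * v^2) = w * v], then expanding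
[h_aff (v^2 * (s + i t)^2)] by real linearity gives the normal form with
[l = kap / (2 * Im w)] and [b = Re w / Im w]. The determinant of [h_aff] is
[kap * Im w = K], which identifies [l] with [kap^2 / (2 * K)]. *)
Lemma half_angle_chart (R : realType) (K theta a : R) :
  1 < K -> fixed_angle K theta a -> exists b, half_angle_normal_form K theta a b.
Proof.
move=> K1 fixa.
pose v := cis (a / 2).
have v2 : cis a = v ^+ 2 by rewrite expr2 /v -cisD -splitr.
have vJ : conjc v * v = 1.
  have := cos2Dsin2 (a / 2); rewrite /v /cis /= mulcE.
  move: (cos _) (sin _) => c s h.
  by apply: complex_ext => /=; [rewrite -h|]; ring.
(* [a] is fixed, so [h_aff (cis a)] squares to a positive multiple of [v ^+ 2];
   the sign of its square root [kap] is lost *)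
have [kap hk] : exists kap : R, h_aff K theta (cis a) = kap%:C * v.
  have [r r0 E] : same_dir (H_sq K theta (cis a)) (cis a).
    apply: same_dir_sym; rewrite -{1}((cis_eq_angle _ _).2 fixa).
    exact: same_dir_Htilde.
  have : h_aff K theta (cis a) ^+ 2 = ((Num.sqrt r)%:C * v) ^+ 2.
    by rewrite exprMn -(rmorphXn (real_complex R)) sqr_sqrtr ?ltW// -v2.
  move/eqP; rewrite eqf_sqr => /orP[] /eqP ->; first by exists (Num.sqrt r).
  by exists (- Num.sqrt r); rewrite rmorphN mulNr.
pose w := h_aff K theta ((0 +i* 1) * cis a) * conjc v.
have hi : h_aff K theta ((0 +i* 1) * cis a) = w * v by rewrite /w -mulrA vJ mulr1.
have kapq : kap * Im w = K.
  rewrite -(h_aff_jacobian K theta a) hk hi.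
  have -> : conjc (kap%:C * v) * (w * v) = kap%:C * w.
    have -> : conjc (kap%:C * v) = kap%:C * conjc v.
      by rewrite -{2}[kap%:C]conjc_real; exact: (rmorphM (@conjc R)).
    by transitivity (kap%:C * w * (conjc v * v)); [ring|rewrite vJ mulr1].
  by case: (w) => p q; rewrite mulcE /= mul0r addr0.
have lamE : inv_multiplier K theta a = kap ^+ 2 / (2 * K).
  rewrite /inv_multiplier /H_sq hk exprMn -(rmorphXn (real_complex R)).
  rewrite normcR_mul ?sqr_ge0//.
  by rewrite -v2 normc_cis mulr1.
have lam0 := inv_multiplier_gt0 theta a K1.
have kap0 : kap != 0 by apply/eqP => k0; move: kapq K1; rewrite k0 mul0r => <-; lra.
have q0 : Im w != 0 by apply/eqP => k0; move: kapq K1; rewrite k0 mulr0 => <-; lra.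
have K0 : K != 0 by rewrite gt_eqF//; lra.
have qE : Im w = K / kap by rewrite -kapq; field.
exists (Re w / Im w) => s t.
set lam := inv_multiplier K theta a.
have -> : cis a * (s +i* t) ^+ 2 =
   (s ^+ 2 - t ^+ 2)%:C * cis a + (2 * s * t)%:C * ((0 +i* 1) * cis a).
  case: (cis a) => x y; rewrite expr2 !mulcE; apply: complex_ext => /=; ring.
rewrite /H_sq h_affD !h_affZ hk hi.
have -> : (s ^+ 2 - t ^+ 2)%:C * (kap%:C * v) + (2 * s * t)%:C * (w * v) =
   (2 * Im w)%:C * (v * ((lam * (s ^+ 2 - t ^+ 2) + Re w / Im w * s * t) +i* (s * t))).
  have -> : lam = kap / (2 * Im w) by rewrite /lam lamE qE; field; rewrite kap0.
  move: q0; case: (w) => p q /= q0; case: (v) => x y.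
  by rewrite !mulcE; apply: complex_ext => /=; field.
rewrite exprMn exprMn -v2 -(rmorphXn (real_complex R)); congr (_%:C * _).
by rewrite /lam lamE qE; field; rewrite K0 kap0.
Qed.

(** [chart a phi x] says that [x = cot ((phi - a) / 2)], in a form that does not
depend on the choice of representatives modulo [2 * pi]. *)
Definition chart {R : realType} (a phi x : R) :=
  same_dir (cis phi) (cis a * (x +i* 1) ^+ 2).

Lemma half_plane_neq0 (R : realType) (a x : R) : cis a * (x +i* 1) ^+ 2 != 0.
Proof.
rewrite mulf_neq0 ?cis_neq0// sqrf_eq0 eq_complex /= oner_eq0 andbF //.
Qed.

Lemma chart_exists (R : realType) (a x : R) : exists phi, chart a phi x.
Proof.
exists (arg (cis a * (x +i* 1) ^+ 2)).
by apply: same_dir_arg; exact: half_plane_neq0.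
Qed.

Lemma chart_onto (R : realType) (a phi : R) :
  ~ eq_angle phi a -> exists x, chart a phi x.
Proof.
move=> na; pose d := (phi - a) / 2.
have E : cis phi = cis a * cis d ^+ 2.
  by rewrite expr2 -!cisD; congr cis; rewrite /d; field.
have s0 : sin d != 0.
  apply/eqP => s0; apply: na; apply/cis_eq_angle; rewrite E.
  have c2 : cos d * cos d = 1.
    by have := cos2Dsin2 d; rewrite s0 expr0n /= addr0 expr2.
  have -> : cis d ^+ 2 = 1.
    rewrite /cis s0 expr2 mulcE c2; apply: complex_ext => /=;
    by rewrite !mulr0 ?subr0 ?mul0r ?addr0.
  by rewrite mulr1.
exists (cos d / sin d); exists (sin d ^+ 2).
  by rewrite lt_neqAle eq_sym sqrf_eq0 s0 sqr_ge0.
rewrite E [RHS]mulrCA; congr (_ * _).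
by rewrite /cis !expr2 !mulcE; apply: complex_ext => /=; field.
Qed.

(** Comparing [(x + i)^2] and [r * (y + i)^2], the imaginary parts give [x = r * y],
and then the real parts give [r = 1] since [r] is positive. *)
Lemma chart_inj (R : realType) (a phi x y : R) :
  chart a phi x -> chart a phi y -> x = y.
Proof.
move=> /same_dir_sym hx hy; have [r r0 e] := same_dir_trans hx hy.
have {e} : cis a * (x +i* 1) ^+ 2 = cis a * (r%:C * (y +i* 1) ^+ 2).
  by rewrite e [LHS]mulrCA.
move=> /(mulfI (cis_neq0 a)); rewrite !expr2 !mulcE => -[e1 e2].
have r1 : r = 1 by nra.
by move: e2; rewrite r1; lra.
Qed.

(** The half-angle chart misses its centre: a real [x] with [(x + i)^2 > 0] would
be both zero and nonzero. *)
Lemma chart_neq (R : realType) (a phi x : R) : chart a phi x -> ~ eq_angle phi a.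
Proof.
move=> [r r0 + /cis_eq_angle E]; rewrite E => e.
have {e} : cis a * 1 = cis a * (r%:C * (x +i* 1) ^+ 2).
  by rewrite mulr1 {1}e [LHS]mulrCA.
move=> /(mulfI (cis_neq0 a)); rewrite expr2 !mulcE => -[e1 e2]; nra.
Qed.

Lemma Htilde_eq_angle (R : realType) (K theta a b : R) :
  eq_angle a b -> Htilde K theta a = Htilde K theta b.
Proof. by move=> /cis_eq_angle E; rewrite /Htilde E. Qed.

Lemma chart_step (R : realType) (K theta a b phi x : R) : 1 < K ->
  half_angle_normal_form K theta a b -> x != 0 -> chart a phi x ->
  chart a (Htilde K theta phi) (lift_map (inv_multiplier K theta a) b x).
Proof.
move=> K1 nf x0 [r r0 E].
apply: same_dir_trans (same_dir_Htilde theta phi K1) _.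
have l0 := inv_multiplier_gt0 theta a K1.
set l := inv_multiplier K theta a in l0 *.
exists (r ^+ 2 * (2 * K / l) * x ^+ 2).
  have x20 : 0 < x ^+ 2 by rewrite lt_neqAle eq_sym sqrf_eq0 x0 sqr_ge0.
  by rewrite mulr_gt0// mulr_gt0 ?exprn_gt0// divr_gt0//; lra.
rewrite E H_sqZ nf -/l.
have -> : (l * (x ^+ 2 - 1 ^+ 2) + b * x * 1) +i* (x * 1) =
  x%:C * (lift_map l b x +i* 1).
  by rewrite mulcE /lift_map; apply: complex_ext => /=; field.
by move: (2 * K / l) => m; ring.
Qed.

Lemma chart_pole (R : realType) (K theta a b phi : R) : 1 < K ->
  half_angle_normal_form K theta a b -> chart a phi 0 ->
  eq_angle (Htilde K theta phi) a.
Proof.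
move=> K1 nf [r r0 E]; apply: same_dir_cis.
apply: same_dir_trans (same_dir_Htilde theta phi K1) _.
have l0 := inv_multiplier_gt0 theta a K1.
set l := inv_multiplier K theta a in l0 *.
exists (r ^+ 2 * (2 * K / l) * l ^+ 2).
  by rewrite mulr_gt0 ?exprn_gt0// mulr_gt0 ?exprn_gt0// divr_gt0//; lra.
rewrite E H_sqZ nf -/l.
have -> : (l * (0 ^+ 2 - 1 ^+ 2) + b * 0 * 1) +i* (0 * 1) = (- l)%:C.
  by apply: complex_ext => /=; ring.
by move: (2 * K / l) => m; ring.
Qed.

Lemma fixed_chart (R : realType) (K theta a b phi x : R) : 1 < K ->
  half_angle_normal_form K theta a b -> chart a phi x -> fixed_angle K theta a ->
  fixed_angle K theta phi <->
  (x != 0 /\ lift_map (inv_multiplier K theta a) b x = x).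
Proof.
move=> K1 nf cx fa; split=> [fphi|[x0 Fx]].
  have x0 : x != 0.
    apply/eqP => x0; move: cx; rewrite x0 => cx; apply: (chart_neq cx).
    apply/cis_eq_angle; have /cis_eq_angle <- := chart_pole K1 nf cx.
    by apply/esym/cis_eq_angle.
  split=> //; apply: (chart_inj (a := a) (phi := phi)) => //.
  have /cis_eq_angle := fphi; rewrite /chart => <-.
  exact: chart_step.
apply: same_dir_cis; have := chart_step K1 nf x0 cx; rewrite Fx.
by move=> h; apply: same_dir_trans h (same_dir_sym cx).
Qed.

Lemma normc_half_plane (R : realType) (x : R) :
  normc ((x +i* 1) ^+ 2) = x ^+ 2 + 1.
Proof.
rewrite expr2 ComplexField.Normc.normcM normc_sqrt /= expr1n -expr2 sqr_sqrtr//.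
by rewrite addr_ge0 ?sqr_ge0.
Qed.

(** At a fixed point [x] of [lift_map], the normal form gives the norm of [H_sq] in
the direction of [x] directly; the result says that the multiplier is
[l * (1 + 1 / x^2)], the derivative of [lift_map] at [x]. *)
Lemma inv_multiplier_chart (R : realType) (K theta a b phi x : R) : 1 < K ->
  half_angle_normal_form K theta a b -> chart a phi x ->
  lift_map (inv_multiplier K theta a) b x = x -> x != 0 ->
  inv_multiplier K theta phi * (inv_multiplier K theta a * (x ^+ 2 + 1)) = x ^+ 2.
Proof.
move=> K1 nf [r r0 E] Fx x0; have l0 := inv_multiplier_gt0 theta a K1.
set l := inv_multiplier K theta a in l0 Fx *.
have n2 := normc_half_plane x.
have rE : r * (x ^+ 2 + 1) = 1.
  have := congr1 (fun z => normc z) E.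
  by rewrite normcR_mul ?(ltW r0)// ComplexField.Normc.normcM !normc_cis mul1r n2.
rewrite {1}/inv_multiplier E H_sqZ nf -/l.
have -> : (l * (x ^+ 2 - 1 ^+ 2) + b * x * 1) +i* (x * 1) =
  x%:C * (x +i* 1).
  have -> : l * (x ^+ 2 - 1 ^+ 2) + b * x * 1 = x * x.
    by transitivity (x * lift_map l b x); [rewrite /lift_map; field|rewrite Fx].
  by rewrite mulcE; apply: complex_ext => /=; ring.
rewrite exprMn -(rmorphXn (real_complex R)) normcR_mul ?sqr_ge0//.
have m0 : 0 <= 2 * K / l by rewrite divr_ge0// ?ltW// mulr_gt0//; lra.
rewrite normcR_mul// ComplexField.Normc.normcM normc_cis mul1r.
rewrite normcR_mul ?sqr_ge0// n2.
have -> : x ^+ 2 + 1 = r^-1 by rewrite -[LHS](mulKf (x := r)) ?gt_eqF// rE mulr1.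
by field; rewrite !gt_eqF//; lra.
Qed.

(** * The multiplier of a fixed angle *)

(** With [d = (x - a) / 2], the normal form at [s = cos d], [t = sin d] shows that
the image direction is that of [cis a * (E + i S)^2] with [S = s * t] and
[E = l * (s^2 - t^2) + b * S], which is positive near [a]. There the angle
swept is [2 * atan (S / E)], a function without jumps. Its derivative at [a]
uses only [S = 0], [E = l] and [S' = 1 / 2] at [a]. *)
Lemma angle_derive_Htilde (R : realType) (K theta a b : R) : 1 < K ->
  fixed_angle K theta a -> half_angle_normal_form K theta a b ->
  angle_derive (Htilde K theta) a = (inv_multiplier K theta a)^-1.
Proof.
move=> K1 fa nf; have l0 := inv_multiplier_gt0 theta a K1.
set l := inv_multiplier K theta a in l0 *.
pose d (x : R) : R := (x - a) / 2.
pose S (x : R) : R := cos (d x) * sin (d x).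
pose E (x : R) : R := l * (cos (d x) ^+ 2 - sin (d x) ^+ 2) + b * S x.
have da : d a = 0 by rewrite /d subrr mul0r.
have dd : is_derive a 1 d 2^-1.
  have -> : d = 2^-1 \*: (id - cst a) by apply/funext => u; rewrite /d mulrC.
  by apply: is_derive_eq; rewrite subr0 /GRing.scale/= mulr1.
have dcos : is_derive a 1 (cos \o d) (- sin (d a) * 2^-1).
  exact: is_derive1_comp.
have dsin : is_derive a 1 (sin \o d) (cos (d a) * 2^-1).
  exact: is_derive1_comp.
rewrite da sin0 cos0 oppr0 mul0r mul1r in dcos dsin.
have dS : is_derive a 1 S 2^-1.
  have -> : S = (cos \o d) * (sin \o d) by [].
  apply: is_derive_eq.
  by rewrite /= da cos0 sin0 /GRing.scale/= mul1r mul0r addr0.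
have [dE dEa] : exists e, is_derive a 1 E e.
  eexists.
  have -> : E = l \*: ((cos \o d) ^+ 2 - (sin \o d) ^+ 2) + b \*: S by [].
  by [].
have Sa : S a = 0 by rewrite /S da sin0 mulr0.
have Ea : E a = l by rewrite /E Sa da cos0 sin0 expr0n expr1n subr0 mulr1 mulr0 addr0.
have dM : is_derive a 1 (fun x => atan (S x / E x)) (2 * l)^-1.
  have -> : (fun x => atan (S x / E x)) = atan \o (S * (fun x => (E x)^-1)) by [].
  have Ea0 : E a != 0 by rewrite Ea gt_eqF.
  have := is_deriveV Ea0 dEa => dV.
  apply: is_derive_eq.
  rewrite Ea Sa /GRing.scale /= !fctE Sa Ea !mul0r expr0n /= addr0 invr1 mul1r add0r.
  by rewrite [RHS]invfM mulrC.
rewrite /angle_derive derive1E.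
have -> : l^-1 = 2 * (2 * l)^-1 by field; rewrite gt_eqF.
have dF : is_derive a 1 (2 \*: (fun x => atan (S x / E x))) (2 * (2 * l)^-1).
  exact: is_derive_eq.
have [_ <-] := dF; apply: near_eq_derive.
have E0 : \forall x \near a, 0 < E x.
  have : E x @[x --> a] --> E a.
    apply: differentiable_continuous; apply/derivable1_diffP.
    exact: ex_derive.
  by move/cvgr_gt; apply; rewrite Ea.
near=> x; rewrite /GRing.scale /=.
have Ex : 0 < E x by near: x.
pose al := atan (S x / E x).
(* [al] is the argument of [E + i S]; squaring doubles it, which stays inside
   the range of [arg] *)
have [r r0 hr] : exists2 r : R, 0 < r &
    cis (Htilde K theta x - Htilde K theta a) = r%:C * cis (2 * al).
  have ca : 0 < cos al by rewrite cos_gt0_pihalf// atan_gtNpi2 atan_ltpi2.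
  have e1 : E x +i* S x = (E x / cos al)%:C * cis al.
    have ta : sin al = S x / E x * cos al.
      by rewrite -{1}[S x / E x]atanK -/al /tan divfK// gt_eqF.
    rewrite /cis mulcE; apply: complex_ext => /=; rewrite ?ta; field;
    by rewrite ?gt_eqF.
  have [r r0 hr] := same_dir_Htilde theta x K1.
  have cx : cis x = cis a * (cos (d x) +i* sin (d x)) ^+ 2.
    by rewrite expr2 -/(cis (d x)) -!cisD; congr cis; rewrite /d; field.
  exists (r * (2 * K / l) * (E x / cos al) ^+ 2).
    have m0 : 0 < 2 * K / l by rewrite divr_gt0//; lra.
    by rewrite mulr_gt0 ?(mulr_gt0 r0 m0)// exprn_gt0// divr_gt0.
  apply: (mulfI (cis_neq0 (Htilde K theta a))).
  rewrite -cisD addrC subrK hr cx nf -/l.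
  have -> : l * (cos (d x) ^+ 2 - sin (d x) ^+ 2) + b * cos (d x) * sin (d x) = E x.
    by rewrite /E /S mulrA.
  rewrite -/(S x) e1 ((cis_eq_angle _ _).2 fa).
  have -> : cis (2 * al) = cis al ^+ 2.
    by rewrite expr2 -cisD; congr cis; ring.
  by move: (2 * K / l) (E x / cos al) => m e; ring.
rewrite hr arg_polar// -/al.
by have := atan_gtNpi2 (S x / E x); have := atan_ltpi2 (S x / E x); rewrite -/al; lra.
Unshelve. all: by end_near.
Qed.

(** * External rays *)

Lemma continuous_real_complex (R : realType) : continuous (fun x : R => x%:C : R[i]).
Proof.
move=> x; apply/cvgrPdist_lt => e e0.
have [Re0 eE] : 0 < Re e /\ e = (Re e)%:C.
  move: e0; rewrite ltcE /= => /andP[/eqP e0 ?]; split => //.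
  by apply: complex_ext.
near=> y; rewrite eE -rmorphB normc_def /= expr0n /= addr0 sqrtr_sqr ltcR.
by near: y; exact: cvgr_dist_lt.
Unshelve. all: by end_near.
Qed.

Lemma continuous_half_plane (R : realType) (u : R[i]) :
  continuous (fun x : R => u * (x +i* 1) ^+ 2).
Proof.
move=> x; have c1 : (y +i* 1) @[y --> x] --> (x +i* 1).
  have -> : (fun y : R => y +i* 1) = (fun y : R => y%:C + (0 +i* 1)).
    by apply/funext => y; apply: complex_ext; rewrite /= ?addr0 ?add0r.
  have -> : x +i* 1 = x%:C + (0 +i* 1) by apply: complex_ext; rewrite /= ?addr0 ?add0r.
  by apply: cvgD; [exact: continuous_real_complex|exact: cvg_cst].
apply: cvgM; first exact: cvg_cst.
by apply: cvgM.
Qed.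

(** The image of [psi] contains all points of large modulus, so no external ray is
empty. *)
Lemma external_ray_point (R : realType) (K theta : R) (c : R[i]) (U : set R[i])
    (psi : R[i] -> R[i]) (phi : R) : bottcher K theta c U psi ->
  exists z t, [/\ 0 < t, psi z = t%:C * cis phi & external_ray U psi phi z].
Proof.
move=> [_ [[r rU] _ _]]; pose t := `|r| + 1.
have t0 : 0 < t by rewrite ltr_wpDl.
have [z Uz zE] : (psi @` U) (t%:C * cis phi).
  apply: rU; change (r < normc (t%:C * cis phi)).
  rewrite normcR_mul ?ltW// normc_cis mulr1 /t.
  by rewrite (le_lt_trans (ler_norm r))// ltrDl.
exists z, t; split=> //; split => //; split; last by exists z.
by exists t => //; exact: ltW.
Qed.

Lemma ray_same_dir (R : realType) (z : R[i]) (phi : R) :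
  z != 0 -> ray phi z -> same_dir z (cis phi).
Proof.
move=> z0 [t t0 E]; exists t => //; rewrite lt_neqAle t0 andbT.
by apply/eqP => t00; move: z0; rewrite E -t00 mul0r eqxx.
Qed.

Lemma real_mul_neq0 (R : realType) (r : R) (z : R[i]) :
  0 < r -> z != 0 -> r%:C * z != 0.
Proof. by move=> r0 z0; rewrite -normc_gt0 normcR_mul ?ltW// mulr_gt0// normc_gt0. Qed.

Lemma external_ray_eq (R : realType) (K theta : R) (c : R[i]) (U : set R[i])
    (psi : R[i] -> R[i]) (a b : R) : bottcher K theta c U psi ->
  external_ray U psi a = external_ray U psi b <-> eq_angle a b.
Proof.
move=> hb; split; last by move=> /cis_eq_angle E; rewrite /external_ray /ray E.
have [z [t [t0 zt + ]]] := external_ray_point a hb.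
move=> /[swap] -> [_ [zb _]]; apply: same_dir_cis.
have z0 : psi z != 0 by rewrite zt; apply: real_mul_neq0 => //; exact: cis_neq0.
apply: same_dir_trans (ray_same_dir z0 zb).
by apply: same_dir_sym; exists t.
Qed.

Lemma external_ray_step (R : realType) (K theta : R) (c : R[i]) (U : set R[i])
    (psi : R[i] -> R[i]) (phi : R) (z : R[i]) : 1 < K -> bottcher K theta c U psi ->
  external_ray U psi phi z ->
  external_ray U psi (Htilde K theta phi) (f_quad K theta c z).
Proof.
move=> K1 [[_ fU _] [_ _ conj]] [Uz [[t t0 zt] _]].
have Uf : U (f_quad K theta c z) by apply: fU; exists z.
split=> //; split; last by exists (f_quad K theta c z).
rewrite /= -conj ?inE// zt H_sqZ.
have [r r0 E] := same_dir_sym (same_dir_Htilde theta phi K1).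
rewrite E; exists (t ^+ 2 * r); first by rewrite mulr_ge0 ?sqr_ge0// ltW.
by rewrite (rmorphM (real_complex R) (t ^+ 2) r) mulrA.
Qed.

Lemma external_ray_iter (R : realType) (K theta : R) (c : R[i]) (U : set R[i])
    (psi : R[i] -> R[i]) (phi : R) (z : R[i]) (n : nat) : 1 < K ->
  bottcher K theta c U psi -> external_ray U psi phi z ->
  external_ray U psi (iter n (Htilde K theta) phi) (iter n (f_quad K theta c) z).
Proof.
move=> K1 hb Ez; elim: n => [//|n IH]; rewrite !iterS.
exact: external_ray_step.
Qed.

(** One point of the external ray whose image under [psi] is nonzero decides: its
image under [H_sq] has the direction of [Htilde phi]. *)
Lemma fixed_external_ray (R : realType) (K theta : R) (c : R[i]) (U : set R[i])
    (psi : R[i] -> R[i]) (phi : R) : 1 < K -> bottcher K theta c U psi ->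
  fixed_set K theta c (external_ray U psi phi) <-> fixed_angle K theta phi.
Proof.
move=> K1 hb; split=> [fx|fphi]; last first.
  move=> _ [z Ez <-].
  by rewrite -((external_ray_eq _ _ hb).2 fphi); exact: external_ray_step.
have [z [t [t0 zt Ez]]] := external_ray_point phi hb.
have [_ [fphi _]] : external_ray U psi phi (f_quad K theta c z).
  by apply: fx; exists z.
have [Uz _] := Ez; have [_ [_ _ conj]] := hb.
rewrite /= -conj ?inE// zt H_sqZ in fphi.
have t20 : 0 < t ^+ 2 by rewrite exprn_gt0.
have h0 := real_mul_neq0 t20 (H_sq_cis_neq0 theta phi K1).
apply: same_dir_cis; apply: same_dir_trans (ray_same_dir h0 fphi).
apply: same_dir_trans (same_dir_Htilde theta phi K1) _.
by apply: same_dir_sym; exists (t ^+ 2).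
Qed.

(** The neighbourhood of infinity is the part of [U] that [psi] sends to a region
[r < |w|] inside the image of [psi]. A point [z] in it with [psi z] off the ray
of angle [a] has [psi z = gam x] on the curve [gam y = u * (y + i)^2], which
crosses every direction other than [a]; points [gam y] with [y] near [x] in the
dense set lie on the rays wanted, and the inverse of [psi], being continuous on
the open image of [psi], brings them back near [z]. *)
Lemma dense_near_infty_rays (R : realType) (K theta : R) (c : R[i])
    (U : set R[i]) (psi : R[i] -> R[i]) (D : set R) (a : R) (A : set R[i]) :
  bottcher K theta c U psi -> D a ->
  dense_in_line (fun x => forall phi, chart a phi x -> D phi) ->
  (forall phi, D phi -> external_ray U psi phi `<=` A) ->
  dense_near_infty A.
Proof.
move=> hb Da Dd DA.
have [[[r1 r1U] _ [[oU oW _ [g [gK gc]]] _ _]] [[r2 r2U] inv _]] := hb.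
pose r := Num.max 0 r2.
have [r3 r3V] : nbhs_infty (psi @^-1` [set z | r < normc z]).
  by apply: inv; exists r.
exists (U `&` psi @^-1` [set z | r < normc z]); split.
  exists (Num.max r1 r3) => z /=; rewrite gt_max => /andP[? ?].
  by split; [exact: r1U|exact: r3V].
move=> z [Uz rz].
have [r0 r2r] : 0 <= r /\ r2 <= r by rewrite /r !le_max !lexx orbT.
have n0 : 0 < normc (psi z) by exact: le_lt_trans rz.
have z0 : psi z != 0 by rewrite -normc_gt0.
pose phi := arg (psi z).
have zphi : psi z = (normc (psi z))%:C * cis phi by exact: polar_decomposition.
have [/cis_eq_angle pa|pa] := pselect (eq_angle phi a).
  apply: subset_closure; split=> //; apply: (DA a Da); split=> //; split.
    by exists (normc (psi z)); [exact: ltW|rewrite -pa].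
  by exists z.
have [x [rho rho0 xE]] := chart_onto pa.
pose u := (normc (psi z) * rho)%:C * cis a.
pose gam (y : R) := u * (y +i* 1) ^+ 2.
have gx : gam x = psi z.
  by rewrite zphi xE /gam /u rmorphM !mulrA.
have gamc := @continuous_half_plane R u x; rewrite -/gam in gamc.
have gxW : (psi @` U) (gam x) by rewrite gx; exists z.
have gamW : \forall y \near x, (psi @` U) (gam y).
  by apply: gamc; apply: open_nbhs_nbhs; split.
have gamr : \forall y \near x, r < normc (gam y).
  have : normc u * (y ^+ 2 + 1) @[y --> x] --> normc u * (x ^+ 2 + 1).
    apply: cvgM; first exact: cvg_cst.
    by apply: cvgD; [exact: exprn_continuous|exact: cvg_cst].
  have nE y : normc (gam y) = normc u * (y ^+ 2 + 1).
    by rewrite ComplexField.Normc.normcM normc_half_plane.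
  move/cvgr_gt => /(_ r); rewrite -nE gx => /(_ rz).
  by apply: filterS => y; rewrite nE.
move=> B Bz.
have gamB : \forall y \near x, B (g (gam y)).
  rewrite continuous_open_subspace// in gc.
  apply: (gamc (g @^-1` B)); apply: (gc (gam x)); first by rewrite inE.
  by rewrite gx gK ?inE.
have [e /= e0 he] : nbhs_ball x [set y |
    [/\ (psi @` U) (gam y), r < normc (gam y) & B (g (gam y))]].
  by apply/nbhs_ballP; near=> y; split; near: y.
have [y /andP[xy yx] Dy] := Dd x (x + e / 2) (ltac:(by rewrite ltrDl divr_gt0)).
have [[v Uv vE] ry By] : [/\ (psi @` U) (gam y), r < normc (gam y) & B (g (gam y))].
  by apply: he; rewrite /ball /= distrC ger0_norm ?subr_ge0//; lra.
have [phi' cphi'] := chart_exists a y.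
rewrite -vE gK ?inE// in By; rewrite -vE in ry.
exists v; split=> //; split=> //; apply: (DA phi' (Dy _ cphi')).
split=> //; split; last by exists v.
have [s s0 sE] := same_dir_sym cphi'.
exists (normc (psi z) * rho * s).
  by rewrite ?mulr_ge0 ?ltW.
rewrite /= vE /gam /u -mulrA sE mulrA.
by rewrite -(rmorphM (real_complex R) (normc (psi z) * rho) s).
Unshelve. all: by end_near.
Qed.

(** * Fixed angles and their basins *)

Lemma card_two_points (T : Type) (A : set T) (n : nat) :
  A #= `I_n -> (1 < n)%N -> exists x y, [/\ A x, A y & x <> y].
Proof.
move=> cA n1; apply: contrapT => nA.
have nE m : A #= `I_m -> m = n.
  by move=> cA'; apply/card_eq_II; exact: card_eq_trans (card_esym cA') cA.
have [[x Ax]|A0] := pselect (A !=set0).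
  have A1 : A = [set x].
    apply/seteqP; split=> [y Ay|_ -> //]; apply: contrapT => yx.
    by apply: nA; exists y, x.
  by move: n1; rewrite -(nE 1%N) // A1 card_set1.
have A00 : A = set0 by apply/seteqP; split=> // y Ay; apply: A0; exists y.
by move: n1; rewrite -(nE 0%N) // A00 II0 card_eq00.
Qed.

Lemma locally_repellingE (R : realType) (K theta a : R) : 1 < K ->
  fixed_angle K theta a -> locally_repelling K theta a <-> inv_multiplier K theta a < 1.
Proof.
move=> K1 fa; have [b nf] := half_angle_chart K1 fa.
rewrite /locally_repelling (angle_derive_Htilde K1 fa nf).
by rewrite invf_gt1 ?inv_multiplier_gt0//; split=> [[]|].
Qed.

Lemma lift_map_fixed (R : realType) (l b x : R) : x != 0 ->
  lift_map l b x = x <-> (1 - l) * x ^+ 2 - b * x + l = 0.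
Proof.
move=> x0; have -> : (1 - l) * x ^+ 2 - b * x + l = x * (x - lift_map l b x).
  by rewrite /lift_map; field.
split=> [->|/eqP]; first by rewrite subrr mulr0.
by rewrite mulf_eq0 (negbTE x0) subr_eq0 => /eqP.
Qed.

(** The quadratic polynomial of [lift_map_fixed] has no real zero, hence a negative
discriminant, unless it degenerates to the nonzero constant [l]. *)
Lemma lift_map_no_fixed_point (R : realType) (l b : R) : 0 < l ->
  (forall x, x != 0 -> lift_map l b x <> x) ->
  (0 < l < 1 /\ b ^+ 2 < 4 * l * (1 - l)) \/ (l = 1 /\ b = 0).
Proof.
move=> l0 nfix.
have nroot x : (1 - l) * x ^+ 2 - b * x + l <> 0.
  move=> Qx; have x0 : x != 0.
    by apply/eqP => x0; move: Qx; rewrite x0 expr0n /= !mulr0; lra.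
  by apply: (nfix x x0); apply/lift_map_fixed.
have [l1|l1] := eqVneq l 1.
  right; split=> //; apply/eqP/negP => /negP b0; apply: (nroot b^-1).
  by rewrite l1 mulfV//; ring.
have disc : b ^+ 2 < 4 * l * (1 - l).
  rewrite ltNge; apply/negP => d0.
  apply: (nroot ((b + Num.sqrt (b ^+ 2 - 4 * l * (1 - l))) / (2 * (1 - l)))).
  have s2 : Num.sqrt (b ^+ 2 - 4 * l * (1 - l)) ^+ 2 = b ^+ 2 - 4 * l * (1 - l).
    by rewrite sqr_sqrtr// subr_ge0.
  move: (Num.sqrt _) s2 => s s2.
  have l1' : 1 - l != 0 by rewrite subr_eq0 eq_sym.
  transitivity ((s ^+ 2 - (b ^+ 2 - 4 * l * (1 - l))) / (4 * (1 - l))).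
    by field.
  by rewrite s2 subrr mul0r.
left; split=> //; rewrite l0/=.
by have := sqr_ge0 b; nra.
Qed.

Lemma chart_atan (R : realType) (a y : R) : y != 0 -> chart a (a + 2 * atan y^-1) y.
Proof.
move=> y0; pose al := atan y^-1.
have ca : 0 < cos al by rewrite cos_gt0_pihalf// atan_gtNpi2 atan_ltpi2.
have ta : sin al = y^-1 * cos al.
  by rewrite -{1}[y^-1]atanK -/al /tan divfK// gt_eqF.
exists ((cos al / y) ^+ 2).
  by rewrite lt_neqAle eq_sym sqrf_eq0 mulf_neq0 ?invr_eq0 ?sqr_ge0// gt_eqF.
have -> : cis (a + 2 * al) = cis a * cis al ^+ 2.
  by rewrite expr2 -!cisD; congr cis; ring.
have -> : cis al = (cos al / y)%:C * (y +i* 1).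
  by rewrite /cis mulcE ta; apply: complex_ext => /=; field.
by move: (cos al / y) => m; ring.
Qed.

Lemma chart_eq_angle (R : realType) (a phi phi' x : R) :
  chart a phi x -> chart a phi' x -> eq_angle phi phi'.
Proof.
by move=> h h'; apply: same_dir_cis; apply: same_dir_trans h (same_dir_sym h').
Qed.

Lemma fixed_angle_iter (R : realType) (K theta a phi : R) (n : nat) :
  fixed_angle K theta a -> eq_angle phi a ->
  eq_angle (iter n (Htilde K theta) phi) a.
Proof.
move=> fa pa; elim: n => [//|n IH]; rewrite iterS.
by rewrite (Htilde_eq_angle _ _ IH).
Qed.

Definition attracted {R : realType} (K theta a : R) (phi : R) :=
  cvg_angle (fun n => iter n (Htilde K theta) phi) a.

Lemma attracted_fixed (R : realType) (K theta a phi : R) :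
  fixed_angle K theta a -> eq_angle phi a -> attracted K theta a phi.
Proof.
move=> fa pa; exists (fun=> a); split; last exact: cvg_cst.
by move=> n; apply/cis_eq_angle/esym/cis_eq_angle; exact: fixed_angle_iter.
Qed.

Lemma attracted_step (R : realType) (K theta a phi : R) :
  attracted K theta a (Htilde K theta phi) -> attracted K theta a phi.
Proof.
move=> [v [vE va]]; exists (fun n => if n is m.+1 then v m else phi); split.
  by case=> [|n]; [exists 0; rewrite mulr0 addr0|rewrite iterSr].
by rewrite -cvg_shiftS.
Qed.

(** The point at infinity of the chart is the angle [a], and [a + 2 * atan (1 / y)]
is a representative of the angle with coordinate [y] that tends to [a] as [y]
goes to infinity in either direction. *)
Lemma attracted_escape (R : realType) (K theta a b phi x d : R) : 1 < K ->
  half_angle_normal_form K theta a b -> chart a phi x -> 0 < d ->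
  (forall n, d * n.+1%:R <= `|iter n (lift_map (inv_multiplier K theta a) b) x|) ->
  attracted K theta a phi.
Proof.
move=> K1 nf cx d0; set F := lift_map _ b => hx.
have n0 n : iter n F x != 0.
  by rewrite -normr_gt0; apply: lt_le_trans (hx n); rewrite mulr_gt0.
have cn n : chart a (iter n (Htilde K theta) phi) (iter n F x).
  by elim: n => [//|n IH]; rewrite !iterS; exact: chart_step.
exists (fun n => a + 2 * atan (iter n F x)^-1); split.
  by move=> n; apply: chart_eq_angle (chart_atan a (n0 n)) (cn n).
have y0 : (iter n F x)^-1 @[n --> \oo] --> (0 : R).
  apply/norm_cvg0P.
  have h0 : d^-1 * (n.+1%:R)^-1 @[n --> \oo] --> (0 : R).
    rewrite -[0](mulr0 d^-1); apply: cvgM; first exact: cvg_cst.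
    exact: cvg_harmonic.
  apply: (squeeze_cvgr _ (cvg_cst 0) h0); apply: nearW => n.
  by rewrite normr_ge0/= normfV -invfM lef_pV2 ?posrE ?mulr_gt0 ?normr_gt0.
rewrite -{2}[a]addr0 -[X in a + X](mulr0 2) -atan0.
apply: cvgD; first exact: cvg_cst.
apply: cvgM; first exact: cvg_cst.
by apply: continuous_cvg => //; exact: continuous_atan.
Qed.

(** [N] is the absolute value, or a signed coordinate when only one side escapes. *)
Lemma linear_escape (R : realType) (f N : R -> R) (M d x : R) :
  d <= M -> (forall y, N y <= `|y|) -> 0 < d ->
  (forall y, M < N y -> N y + d <= N (f y)) ->
  M < N x -> forall n, d * n.+1%:R <= `|iter n f x|.
Proof.
move=> dM Nle d0 grow Mx n; apply: le_trans (Nle _).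
suff [] : d * n.+1%:R <= N (iter n f x) /\ M < N (iter n f x) by [].
elim: n => [|n [IH1 IH2]]; first by rewrite mulr1; split=> //=; lra.
rewrite iterS; have := grow _ IH2.
by rewrite -(natr1 n.+1); split; lra.
Qed.

Lemma backward_closed_chart (R : realType) (K theta a b : R) (D : R -> Prop) :
  1 < K -> half_angle_normal_form K theta a b ->
  (forall phi, eq_angle phi a -> D phi) ->
  (forall phi, D (Htilde K theta phi) -> D phi) ->
  backward_closed (inv_multiplier K theta a) b
    (fun x => forall phi, chart a phi x -> D phi).
Proof.
move=> K1 nf Da Dstep; split=> [phi cphi|x x0 Gx phi cphi].
  by apply/Dstep/Da; exact: chart_pole cphi.
by apply/Dstep/Gx; exact: chart_step.
Qed.

(** For [l > 1] the points with large absolute value escape, as [F x] is close to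
[l * x]; for [l = 1] those far away on the side of the sign of [b] do, as each
step adds at least [|b| / 2] once [1 / |x| <= |b| / 2]. *)
Lemma dense_attracted (R : realType) (K theta a b : R) : 1 < K ->
  fixed_angle K theta a -> half_angle_normal_form K theta a b ->
  1 <= inv_multiplier K theta a -> (inv_multiplier K theta a = 1 -> b != 0) ->
  dense_in_line (fun x => forall phi, chart a phi x -> attracted K theta a phi).
Proof.
move=> K1 fa nf.
have bc := backward_closed_chart K1 nf (fun phi => @attracted_fixed R K theta a phi fa)
  (@attracted_step R K theta a).
have esc x d := fun phi cphi => @attracted_escape R K theta a b phi x d K1 nf cphi.
move: bc esc; set l := inv_multiplier K theta a => bc esc.
rewrite le_eqVlt => /orP[/eqP l1|l1 _].
  move=> /(_ (esym l1)) b0; rewrite -l1 in bc esc.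
  pose B := `|b|; have B0 : 0 < B by rewrite normr_gt0.
  have sgb : Num.sg b * b = B by rewrite -normrEsg.
  have sg2 : Num.sg b * Num.sg b = 1 by rewrite -expr2 sqr_sg b0.
  (* beyond [2 / B] a step advances by [B / 2]; adding [B / 2] to the threshold
     makes it at least one step long, as [linear_escape] requires *)
  apply: (@dense_parabolic _ b (2 / B + B / 2)) bc => // x Mx phi cphi.
  apply: (esc x (B / 2) phi cphi); first by rewrite divr_gt0.
  apply: (linear_escape (N := fun y => Num.sg b * y)) Mx.
  - by rewrite lerDr ltW// divr_gt0.
  - by move=> y; apply: le_trans (ler_norm _) _; rewrite normrM normr_sg b0 mul1r.
  - by rewrite divr_gt0.
  - move=> y My.
    have M0 : 0 < 2 / B by rewrite divr_gt0.
    have N0 : 0 < Num.sg b * y by lra.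
    have inv : Num.sg b * y^-1 = (Num.sg b * y)^-1.
      apply: (mulIf (lt0r_neq0 N0)); rewrite mulVf ?gt_eqF// mulrACA sg2 mul1r.
      by rewrite mulVf//; apply/eqP => y0; move: N0; rewrite y0 mulr0 ltxx.
    have small : (Num.sg b * y)^-1 <= B / 2.
      by rewrite -[B / 2]invrK invf_div lef_pV2 ?posrE//; lra.
    by rewrite /lift_map mul1r mulrDr mulrBr inv sgb; lra.
(* chosen so that [l * |x| - l / |x| - |b| >= |x| + 1] as soon as [|x| > M] *)
pose M := (l + `|b| + 1) / (l - 1) + 1.
have l10 : 0 < l - 1 by rewrite subr_gt0.
have b0 := normr_ge0 b.
have M1 : 1 <= M by rewrite lerDr divr_ge0 ?(ltW l10)//; lra.
apply: (@dense_hyperbolic _ l b M) bc => // x Mx phi cphi.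
apply: (esc x 1 phi cphi) => //.
apply: (linear_escape (N := fun y => `|y|)) Mx => // y My.
have y1 : `|y|^-1 <= 1 by rewrite invf_le1; lra.
have ME : (l - 1) * M = l + `|b| + 1 + (l - 1).
  by rewrite /M; field; rewrite gt_eqF.
have ly : l * `|y| <= `|lift_map l b y| + l * `|y|^-1 + `|b|.
  have -> : l * `|y| = `|lift_map l b y + l * y^-1 - b|.
    have -> : lift_map l b y + l * y^-1 - b = l * y by rewrite /lift_map; ring.
    by rewrite normrM gtr0_norm//; lra.
  apply: le_trans (ler_normB _ _) _; rewrite lerD2r.
  apply: le_trans (ler_normD _ _) _; rewrite lerD2l.
  by rewrite normrM normfV gtr0_norm//; lra.
have h1 : (l - 1) * M <= (l - 1) * `|y| by rewrite ler_pM2l// ltW.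
have h2 : l * `|y|^-1 <= l by rewrite ler_piMr//; lra.
lra.
Qed.

(** If [a] is repelling, the two fixed points of [lift_map] have product
[l / (1 - l)], so for one of them [l / (1 - l) <= x^2], which is the condition
for its multiplier [l * (1 + 1 / x^2)] to be at most 1. The other zero of the
quadratic polynomial is [y = l / ((1 - l) * x)]. *)
Lemma exists_nonrepelling (R : realType) (K theta a a' : R) : 1 < K ->
  fixed_angle K theta a -> fixed_angle K theta a' -> ~ eq_angle a' a ->
  exists2 a0, fixed_angle K theta a0 & 1 <= inv_multiplier K theta a0.
Proof.
move=> K1 fa fa' na; have [b nf] := half_angle_chart K1 fa.
have l0 := inv_multiplier_gt0 theta a K1.
have [l1|l1] := leP 1 (inv_multiplier K theta a); first by exists a.
set l := inv_multiplier K theta a in l0 l1 nf *.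
suff [x [x0 Fx xl]] : exists x, [/\ x != 0, lift_map l b x = x &
    l <= (1 - l) * x ^+ 2].
  have [phi cphi] := chart_exists a x.
  exists phi; first by apply/(fixed_chart K1 nf cphi fa).
  have := inv_multiplier_chart K1 nf cphi Fx x0; rewrite -/l => E.
  have x2 : 0 < x ^+ 2 + 1 by rewrite ltr_wpDl ?sqr_ge0.
  rewrite -(ler_pM2r (mulr_gt0 l0 x2)) E; lra.
have [x cx] := chart_onto na.
have [x0 Fx] := (fixed_chart K1 nf cx fa).1 fa'.
have [xl|xl] := leP l ((1 - l) * x ^+ 2); first by exists x.
have l1' : 0 < 1 - l by lra.
pose y := l / ((1 - l) * x).
have y0 : y != 0.
  apply: mulf_neq0; first exact: lt0r_neq0.
  by rewrite invr_eq0 mulf_neq0// lt0r_neq0.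
exists y; split=> //.
  apply/lift_map_fixed => //; move/(lift_map_fixed l b x0): Fx => Qx.
  transitivity (l / ((1 - l) * x ^+ 2) * ((1 - l) * x ^+ 2 - b * x + l)).
    by rewrite /y; field; rewrite x0 gt_eqF.
  by rewrite Qx mulr0.
have x2 : 0 < x ^+ 2 by rewrite lt_neqAle eq_sym sqrf_eq0 x0 sqr_ge0.
have -> : (1 - l) * y ^+ 2 = l * (l / ((1 - l) * x ^+ 2)).
  by rewrite /y; field; rewrite x0 gt_eqF.
have d0 : 0 < (1 - l) * x ^+ 2 by exact: mulr_gt0.
by apply: ler_peMr; rewrite ?(ltW l0)// ler_pdivlMr// mul1r ltW.
Qed.

Theorem corollary2p6 (R : realType) (K theta : R) (c : R[i]) (U : set R[i])
    (psi : R[i] -> R[i])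
    (hK : 1 < K) (htheta : - (pi / 2) < theta <= pi / 2)
    (hpsi : bottcher K theta c U psi) :
  (forall phi : R,
     fixed_external_rays K theta c U psi = [set external_ray U psi phi] ->
     dense_near_infty
       (iterated_preimages K theta c (external_ray U psi phi))) /\
  (fixed_external_rays K theta c U psi #= `I_2 \/
   fixed_external_rays K theta c U psi #= `I_3 ->
   exists phi0 : R,
     [/\ fixed_set K theta c (external_ray U psi phi0),
         ~ locally_repelling K theta phi0,
         (forall phi : R, fixed_set K theta c (external_ray U psi phi) ->
            ~ locally_repelling K theta phi ->
            external_ray U psi phi = external_ray U psi phi0)
       & dense_near_infty (basin K theta U psi phi0)]).
Proof.
split=> [phi Ephi|card].
  have fphi : fixed_angle K theta phi.
    apply/(fixed_external_ray phi hK hpsi).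
    by have [] : fixed_external_rays K theta c U psi (external_ray U psi phi)
      by rewrite Ephi.
  have uniq phi' : fixed_angle K theta phi' -> eq_angle phi' phi.
    move=> fphi'; apply/(external_ray_eq phi' phi hpsi).
    suff : fixed_external_rays K theta c U psi (external_ray U psi phi') by rewrite Ephi.
    by split; [apply/(fixed_external_ray phi' hK hpsi)|exists phi'].
  have [b nf] := half_angle_chart hK fphi.
  have l0 := inv_multiplier_gt0 theta phi hK.
  pose D phi' := exists k, eq_angle (iter k (Htilde K theta) phi') phi.
  have Dphi phi' : eq_angle phi' phi -> D phi' by exists 0%N.
  have Dstep phi' : D (Htilde K theta phi') -> D phi'.
    by move=> [k hk]; exists k.+1; rewrite iterSr.
  have bc := backward_closed_chart hK nf Dphi Dstep.
  have nofix x : x != 0 -> lift_map (inv_multiplier K theta phi) b x <> x.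
    move=> x0 Fx; have [phi' cphi'] := chart_exists phi x.
    apply: (chart_neq cphi'); apply: uniq.
    by apply/(fixed_chart hK nf cphi' fphi).
  apply: (dense_near_infty_rays (D := D) (a := phi) hpsi).
  - by apply: Dphi; exists 0; rewrite mulr0 addr0.
  - have [[l01 disc]|[l1 b0]] := lift_map_no_fixed_point l0 nofix.
      exact: dense_elliptic bc.
    by rewrite l1 b0 in bc; exact: dense_boole.
  - move=> phi' [k hk] z Ez; exists k => //=.
    by rewrite -((external_ray_eq _ _ hpsi).2 hk); exact: external_ray_iter.
have [E1 [E2 [[f1 [a1 e1]] [f2 [a2 e2]] n12]]] : exists E1 E2,
    [/\ fixed_external_rays K theta c U psi E1,
        fixed_external_rays K theta c U psi E2 & E1 <> E2].
  by case: card => /card_two_points; apply.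
rewrite e1 in f1 n12; rewrite e2 in f2 n12.
have {}f1 := (fixed_external_ray a1 hK hpsi).1 f1.
have {}f2 := (fixed_external_ray a2 hK hpsi).1 f2.
have n21 : ~ eq_angle a2 a1.
  by move=> /(external_ray_eq a2 a1 hpsi) e; apply: n12.
have [a0 f0 l1] := exists_nonrepelling hK f1 f2 n21.
have [a3 f3 n30] : exists2 a3, fixed_angle K theta a3 & ~ eq_angle a3 a0.
  have [/cis_eq_angle e10|n10] := pselect (eq_angle a1 a0); last by exists a1.
  by exists a2 => // /cis_eq_angle e20; apply/n21/cis_eq_angle; rewrite e10.
have [b nf] := half_angle_chart hK f0.
have l0 := inv_multiplier_gt0 theta a0 hK.
exists a0; split.
- exact/(fixed_external_ray a0 hK hpsi).
- by move=> /(locally_repellingE hK f0); rewrite ltNge l1.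
- move=> phi /(fixed_external_ray phi hK hpsi) fphi nrep.
  apply/(external_ray_eq phi a0 hpsi); apply: contrapT => nphi.
  apply: nrep; apply/(locally_repellingE hK fphi).
  have [x cx] := chart_onto nphi.
  have [x0 Fx] := (fixed_chart hK nf cx f0).1 fphi.
  have E := inv_multiplier_chart hK nf cx Fx x0.
  rewrite ltNge; apply/negP => lphi.
  have x2 := sqr_ge0 x.
  have lx : x ^+ 2 + 1 <= inv_multiplier K theta a0 * (x ^+ 2 + 1).
    by rewrite ler_peMl//; lra.
  have : inv_multiplier K theta a0 * (x ^+ 2 + 1) <= x ^+ 2.
    by rewrite -[X in _ <= X]E ler_peMl//; lra.
  lra.
- apply: (dense_near_infty_rays (D := attracted K theta a0) (a := a0) hpsi).
  + by apply: attracted_fixed => //; exists 0; rewrite mulr0 addr0.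
  + apply: (dense_attracted hK f0 nf l1) => l1'.
    have [x cx] := chart_onto n30.
    have [x0 /(lift_map_fixed _ _ x0)] := (fixed_chart hK nf cx f0).1 f3.
    by rewrite l1' => h; apply/eqP => b0; move: h; rewrite b0; lra.
  + by move=> phi Dphi z Ez; exists phi.
Qed.
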